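(* Let $(X,d)$ be a complete metric space with $|X|\geqslant 3$, let $k\in\mathbb{N}$ with $3\leqslant k\leqslant |X|$, and let $T\colon X\to X$ be a perimetric contraction on $k$-polygons in $X$ that has no periodic points of prime period $i$ for any $i\in\{2,3,\ldots,k-1\}$. Suppose that $T$ has a fixed point $x^\ast$ which is the limit of some iteration sequence $(x_i)_{i\geqslant 0}$, where $x_0\in X$ and $x_i=Tx_{i-1}$ for $i\geqslant 1$, such that $x^\ast\neq x_i$ for all $i\geqslant 0$. Then $x^\ast$ is the unique fixed point of $T$.
   Context: $|X|$ denotes the cardinality of $X$ (possibly infinite). For points $x_1,\ldots,x_k$ of a metric space $(X,d)$, $k\geqslant 3$, put $P(x_1,x_2,\ldots,x_k)=d(x_1,x_2)+d(x_2,x_3)+\cdots+d(x_{k-1},x_k)+d(x_k,x_1)$. For $k\geqslant 3$ and $|X|\geqslant k$, a map $T\colon X\to X$ is a perimetric contraction on $k$-polygons in $X$ if there exists $\lambda\in[0,1)$ such that $P(Tx_1,\ldots,Tx_k)\leqslant\lambda P(x_1,\ldots,x_k)$ for all $k$ pairwise distinct points $x_1,\ldots,x_k\in X$. A point $x\in X$ is a periodic point of period $p$ if $T^p x=x$; its prime period is the least positive integer $p$ with $T^p x=x$. *)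

(* Defs.v *)
From HB Require Import structures.
From mathcomp Require Import all_boot all_order all_algebra.
From mathcomp Require Import boolp classical_sets cardinality reals topology.

Set Implicit Arguments.
Unset Strict Implicit.
Unset Printing Implicit Defensive.

Import Order.TTheory GRing.Theory Num.Theory.

Local Open Scope classical_set_scope.
Local Open Scope ring_scope.

#[short(type="completeMetricType")]
HB.structure Definition CompleteMetric (K : numDomainType) :=
  { M of Metric K M & Complete M }.

(* [ordS] is the cyclic successor of ['I_k], so the last term of the sum is the
   closing side d(x_k, x_1). *)
Definition perimeter (R : realType) (X : metricType R) (k : nat)
    (x : 'I_k -> X) : R :=
  \sum_(i < k) mdist (x i) (x (ordS i)).

(* The standing conditions 3 <= k <= |X| are not part of the predicate. *)
Definition perimetric_contraction (R : realType) (X : metricType R) (k : nat)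
    (T : X -> X) : Prop :=
  exists lambda : R, 0 <= lambda < 1 /\
    forall x : 'I_k -> X, injective x ->
      perimeter (T \o x) <= lambda * perimeter x.

Definition prime_period (X : Type) (T : X -> X) (x : X) (p : nat) : Prop :=
  [/\ (0 < p)%N, iter p T x = x
    & forall q : nat, (0 < q)%N -> iter q T x = x -> (p <= q)%N].

(* Main.v *)
(* If y were a second fixed point, the polygon x*, y, x_n, ..., x_(n+k-3) would
   consist of distinct points for every n. Since T maps the n-th polygon to the
   (n+1)-st one, the perimeters decay geometrically, although each of them is
   at least d(x*, y) > 0. *)

Require Import Defs.
From mathcomp Require Import all_boot all_order all_algebra.
From mathcomp Require Import boolp classical_sets cardinality reals topology.
From mathcomp Require Import normedtype sequences.

Set Implicit Arguments.
Unset Strict Implicit.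
Unset Printing Implicit Defensive.

Import Order.TTheory GRing.Theory Num.Theory numFieldNormedType.Exports.

Local Open Scope classical_set_scope.
Local Open Scope ring_scope.

(** A repetition [x_ i = x_ j] with [i < j] makes the orbit periodic from [i] on, so it returns to
    [x_ i] infinitely often. Each return is at the same positive distance from [l], against
    convergence. *)
Lemma cvg_orbit_injective (R : realType) (X : metricType R) (T : X -> X)
    (x_ : nat -> X) (l : X) :
  (forall i, x_ i.+1 = T (x_ i)) -> x_ i @[i --> \oo] --> l ->
  (forall i, l <> x_ i) -> injective x_.
Proof.
move=> x_S x_l l_neq.
suff neq_lt i j : (i < j)%N -> x_ i <> x_ j.
  move=> i j eq_ij.
  by case: (ltngtP i j) => // [/neq_lt|/neq_lt/nesym].
move=> lt_ij eq_ij.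
have shift n : x_ (i + n)%N = x_ (j + n)%N.
  by elim: n => [|n IHn]; rewrite ?addn0 // !addnS !x_S IHn.
have periodic m : x_ (i + m * (j - i))%N = x_ i.
  elim: m => [|m IHm]; first by rewrite mul0n addn0.
  by rewrite mulSn addnA subnKC 1?ltnW // -shift.
have d_gt0 : 0 < mdist l (x_ i) by rewrite mdist_gt0; apply/eqP.
have [N _ closeN] := metricType_numDomainType.cvgr_dist_lt x_l d_gt0.
(* After [N] full periods of length [j - i >= 1] the index is at least [N], yet the value is still
   [x_ i], so [mdist l (x_ i)] would be less than itself. *)
have /closeN /= : (N <= i + N * (j - i))%N.
  by rewrite (leq_trans _ (leq_addl _ _)) // leq_pmulr // subn_gt0.
by rewrite periodic ltxx.
Qed.

Lemma mdist_le_perimeter (R : realType) (X : metricType R) (k : nat)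
    (x : 'I_k -> X) (i : 'I_k) :
  mdist (x i) (x (ordS i)) <= perimeter x.
Proof.
rewrite /perimeter (bigD1 i) //= lerDl.
by apply: sumr_ge0 => j _; exact: mdist_ge0.
Qed.

(** The bounds tend to 0 because [lambda < 1], and a weak inequality survives the limit. *)
Lemma geometric_lower_bound_le0 (R : realType) (lambda c d : R) :
  0 <= lambda < 1 -> (forall n, d <= lambda ^+ n * c) -> d <= 0.
Proof.
move=> /andP[l_ge0 l_lt1] le_d.
have cvg0 : (fun n => lambda ^+ n * c) n @[n --> \oo] --> (0 : R).
  rewrite -(mul0r c); apply: cvgM; last exact: cvg_cst.
  by apply: cvg_expr; rewrite ger0_norm.
apply: (ler_cvg_to (cvg_cst d) cvg0).
by apply: nearW => n; exact: le_d.
Qed.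

(** The points [p] and [q] are placed at adjacent positions, so that their distance is a side; [n]
    only shifts the orbit part. *)
Definition polygon (X : Type) (p q : X) (x_ : nat -> X) (k n : nat)
    (i : 'I_k) : X :=
  match val i with
  | 0 => p
  | 1 => q
  | m.+2 => x_ (n + m)%N
  end.

Lemma polygon_injective (X : Type) (p q : X) (x_ : nat -> X) (k n : nat) :
  p <> q -> (forall i, p <> x_ i) -> (forall i, q <> x_ i) ->
  injective x_ -> injective (@polygon X p q x_ k n).
Proof.
move=> pq px qx x_inj [i lti] [j ltj] eq_ij; apply: val_inj.
move: i j lti ltj eq_ij => [|[|i]] [|[|j]] lti ltj; rewrite /polygon //=.
- by move=> /px.
- by move=> /esym.
- by move=> /qx.
- by move=> /esym/px.
- by move=> /esym/qx.
- by move=> /x_inj/addnI ->.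
Qed.

Theorem proposition2p12 (R : realType) (X : completeMetricType R)
    (cardX : (`I_3 #<= [set: X])%card)
    (k : nat) (k_ge3 : (3 <= k)%N) (k_le_cardX : (`I_k #<= [set: X])%card)
    (T : X -> X) (contrT : perimetric_contraction k T)
    (no_period : forall i : nat, (2 <= i <= k.-1)%N ->
       ~ exists x : X, prime_period T x i)
    (xstar : X) (fix_xstar : T xstar = xstar)
    (lim_xstar : exists x_ : nat -> X,
       [/\ forall i : nat, x_ i.+1 = T (x_ i),
           x_ i @[i --> \oo] --> xstar
         & forall i : nat, xstar <> x_ i]) :
  T xstar = xstar /\ forall y : X, T y = y -> y = xstar.
Proof.
split=> // y fix_y; apply: contrapT => neq_y.
have [x_ [x_S x_l l_neq]] := lim_xstar.
have x_inj := cvg_orbit_injective x_S x_l l_neq.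
have y_neq i : y <> x_ i.
  (* A fixed point on the orbit would make two consecutive terms equal, against injectivity. *)
  move=> y_i; have /x_inj/eqP : x_ i.+1 = x_ i by rewrite x_S -y_i.
  by rewrite gtn_eqF.
have [lambda [lambda01 contr]] := contrT.
pose c n : 'I_k -> X := polygon xstar y x_ n.
have c_inj n : injective (c n) by apply: polygon_injective => // /esym.
have T_c n : T \o c n = c n.+1.
  (* Positions 0 and 1 hold fixed points of [T]; every other vertex moves one step along the
     orbit. *)
  by apply/funext => -[[|[|m]] ltm]; rewrite /c /polygon //= -x_S addSn.
have decay n : perimeter (c n) <= lambda ^+ n * perimeter (c 0%N).
  elim: n => [|n IHn]; first by rewrite expr0 mul1r.
  rewrite -T_c exprS -mulrA (le_trans (contr _ (@c_inj n))) //.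
  by rewrite ler_wpM2l //; case/andP: lambda01.
have k_gt0 : (0 < k)%N by rewrite (leq_trans _ k_ge3).
have le_d n : mdist xstar y <= lambda ^+ n * perimeter (c 0%N).
  (* The side starting at position 0 ends at position 1, since [1 < k] keeps the cyclic successor
     from wrapping around. *)
  apply: le_trans (decay n); have := mdist_le_perimeter (c n) (Ordinal k_gt0).
  by rewrite /c /polygon /= modn_small // (leq_trans _ k_ge3).
have := geometric_lower_bound_le0 lambda01 le_d.
by rewrite leNgt mdist_gt0 => /negP; apply; apply/eqP => /esym.
Qed.
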